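(* Let $\mathscr{C}$ be the semiring of cardinal numbers. A formal power series $f=\sum_{n=0}^\infty a_nX^n\in\mathscr{C}[[X]]$ satisfies $f^2=f$ if and only if $a_0$ is an idempotent cardinal, i.e. $a_0=0$, $a_0=1$, or $a_0=\lambda$ is an infinite cardinal, and correspondingly: (a) if $a_0=0$, then $f=0$; (b) if $a_0=1$, then either $f=1$, or all of the following hold: every nonzero $a_n$ with $n\geq 1$ is an infinite cardinal; the set $\{n\geq 1: a_n\neq 0\}$ is infinite; and $a_n\geq\sup_{1\leq i\leq n-1}a_ia_{n-i}$ for every $n\geq 1$; (c) if $a_0=\lambda$ is an infinite cardinal, then for every $n\geq 1$: $a_n$ is either $0$ or an infinite cardinal with $a_n\geq\lambda$; $a_n\geq\sup_{1\leq i\leq n-1}a_ia_{n-i}$ whenever $a_n\neq 0$; and $\sup_{1\leq i\leq n-1}a_ia_{n-i}=0$ whenever $a_n=0$.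
   Context: $\mathscr{C}$ is the (class-)semiring of all cardinal numbers in ZFC, with cardinal addition and cardinal multiplication and the usual ordering of cardinals. $\mathscr{C}[[X]]$ is the semiring of formal power series with coefficients in $\mathscr{C}$, with coefficientwise addition and convolution product. The empty supremum (case $n=1$) is $0$. *)

(* Defs.v *)
From HB Require Import structures.
From mathcomp Require Import all_boot all_order all_algebra.
From mathcomp Require Import generic_quotient.
From mathcomp Require Import mathcomp_extra boolp classical_sets functions.
From mathcomp Require Import cardinality.

Set Implicit Arguments.
Unset Strict Implicit.
Unset Printing Implicit Defensive.

Import Order.TTheory GRing.Theory.
Local Open Scope classical_set_scope.
Local Open Scope ring_scope.
Local Open Scope card_scope.
Local Open Scope quotient_scope.

(* Cardinal numbers are the types of a fixed universe modulo equipotence.  The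
   quotient lives one universe higher: it plays the role of a proper class. *)
Definition small : Type := Type.
HB.instance Definition _ := gen_eqMixin small.
HB.instance Definition _ := gen_choiceMixin small.

Definition equipotent (T U : small) : bool := [set: T] #= [set: U].

Lemma equipotentP (T U : small) :
  reflect (exists f : T -> U, bijective f) (equipotent T U).
Proof.
apply: (iffP idP) => [TU|[f]]; last first.
  rewrite -setTT_bijective => /Pbij[g _]; exact: (pcard_eq g).
have [u|U0] := pselectT U.
  have := TU; rewrite /equipotent card_eq_sym.
  have -> : [set: U] = set0 by rewrite predeqE => x; case: (u x).
  rewrite card_eq_le => /andP[_]; rewrite card_le0 => /eqP T0.
  have t (x : T) : False by have : [set: T] x by []; rewrite T0.
  by exists (fun x => match t x with end), (fun x => match u x with end) => x;
    [case: (t x)|case: (u x)].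
pose P : pointedType := HB.pack (U : Type) (gen_eqMixin U) (gen_choiceMixin U)
  (isPointed.Build U U0).
have /(@pcard_eqP T P)[f] := TU.
by exists f; apply: bijTT.
Qed.

Lemma equipotent_refl : reflexive equipotent.
Proof. by move=> T; apply/equipotentP; exists id, id. Qed.

Lemma equipotent_sym : symmetric equipotent.
Proof. by move=> T U; exact: card_eq_sym. Qed.

Lemma equipotent_trans : transitive equipotent.
Proof. by move=> T U V; exact: card_eq_trans. Qed.

Canonical equipotent_equiv :=
  EquivRel equipotent equipotent_refl equipotent_sym equipotent_trans.

Definition cardinal := {eq_quot equipotent}.
HB.instance Definition _ := Choice.on cardinal.
HB.instance Definition _ := EqQuotient.on cardinal.

Definition cardinal_of (T : small) : cardinal := \pi_cardinal T.

Lemma cardinal_ofP (T U : small) :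
  cardinal_of T = cardinal_of U <-> exists f : T -> U, bijective f.
Proof. by split=> [/eqmodP/equipotentP|/equipotentP/eqmodP]. Qed.

Lemma cardinal_ofK (k : cardinal) : cardinal_of (repr k) = k.
Proof. exact: reprK. Qed.

Lemma repr_cardinal_of (T : small) :
  exists f : repr (cardinal_of T) -> T, bijective f.
Proof. by apply/cardinal_ofP; rewrite cardinal_ofK. Qed.

Definition cadd (k l : cardinal) : cardinal :=
  cardinal_of (repr k + repr l)%type.
Definition cmul (k l : cardinal) : cardinal :=
  cardinal_of (repr k * repr l)%type.

Lemma caddE (T U : small) :
  cadd (cardinal_of T) (cardinal_of U) = cardinal_of (T + U)%type.
Proof.
have [f [f' fK f'K]] := repr_cardinal_of T.
have [g [g' gK g'K]] := repr_cardinal_of U.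
apply/cardinal_ofP; exists (fun x => match x with
  inl t => inl (f t) | inr u => inr (g u) end).
exists (fun x => match x with inl t => inl (f' t) | inr u => inr (g' u) end).
  by case=> x; rewrite ?fK ?gK.
by case=> x; rewrite ?f'K ?g'K.
Qed.

Lemma cmulE (T U : small) :
  cmul (cardinal_of T) (cardinal_of U) = cardinal_of (T * U)%type.
Proof.
have [f [f' fK f'K]] := repr_cardinal_of T.
have [g [g' gK g'K]] := repr_cardinal_of U.
apply/cardinal_ofP; exists (fun x => (f x.1, g x.2)).
exists (fun x => (f' x.1, g' x.2)).
  by case=> x y /=; rewrite fK gK.
by case=> x y /=; rewrite f'K g'K.
Qed.

Lemma caddA : associative cadd.
Proof.
move=> k l m; rewrite -(cardinal_ofK k) -(cardinal_ofK l) -(cardinal_ofK m).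
rewrite !caddE; apply/cardinal_ofP.
exists (fun x => match x with inl a => inl (inl a)
  | inr (inl b) => inl (inr b) | inr (inr c) => inr c end).
by exists (fun x => match x with inl (inl a) => inl a
  | inl (inr b) => inr (inl b) | inr c => inr (inr c) end);
  [case=> [|[]]|case=> [[]|]].
Qed.

Lemma caddC : commutative cadd.
Proof.
move=> k l; apply/cardinal_ofP.
exists (fun x => match x with inl a => inr a | inr b => inl b end).
by exists (fun x => match x with inl a => inr a | inr b => inl b end); case.
Qed.

Lemma cadd0 : left_id (cardinal_of void) cadd.
Proof.
move=> k; rewrite -(cardinal_ofK k) caddE; apply/cardinal_ofP.
exists (fun x => match x with inl a => of_void _ a | inr b => b end).
by exists inr => // -[].
Qed.

Lemma cmulA : associative cmul.
Proof.
move=> k l m; rewrite -(cardinal_ofK k) -(cardinal_ofK l) -(cardinal_ofK m).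
rewrite !cmulE; apply/cardinal_ofP.
exists (fun x => (x.1, x.2.1, x.2.2)).
by exists (fun x => (x.1.1, (x.1.2, x.2))); [case=> ? []|case=> -[]].
Qed.

Lemma cmulC : commutative cmul.
Proof.
move=> k l; apply/cardinal_ofP.
by exists (fun x => (x.2, x.1)), (fun x => (x.2, x.1)); case.
Qed.

Lemma cmul1 : left_id (cardinal_of unit) cmul.
Proof.
move=> k; rewrite -(cardinal_ofK k) cmulE; apply/cardinal_ofP.
by exists snd, (pair tt) => [[[]]|].
Qed.

Lemma cmulDl : left_distributive cmul cadd.
Proof.
move=> k l m; rewrite -(cardinal_ofK k) -(cardinal_ofK l) -(cardinal_ofK m).
rewrite caddE !cmulE caddE; apply/cardinal_ofP.
exists (fun x => match x with (inl a, c) => inl (a, c)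
  | (inr b, c) => inr (b, c) end).
by exists (fun x => match x with inl (a, c) => (inl a, c)
  | inr (b, c) => (inr b, c) end); [case=> -[]|case=> -[]].
Qed.

Lemma cmul0 : left_zero (cardinal_of void) cmul.
Proof.
move=> k; rewrite -(cardinal_ofK k) cmulE; apply/cardinal_ofP.
by exists fst, (of_void _) => [[[]]|].
Qed.

Lemma cardinal1_neq0 : cardinal_of unit != cardinal_of void.
Proof. by apply/eqP => /cardinal_ofP[f _]; case: (f tt). Qed.

HB.instance Definition _ := GRing.isNmodule.Build cardinal caddA caddC cadd0.
HB.instance Definition _ := GRing.Nmodule_isComNzSemiRing.Build cardinal
  cmulA cmulC cmul1 cmulDl cmul0 cardinal1_neq0.

Definition cle (k l : cardinal) : bool := [set: repr k] #<= [set: repr l].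
Definition clt (k l : cardinal) : bool := (l != k) && cle k l.

Lemma cle_refl : reflexive cle.
Proof. by move=> k; exact: card_lexx. Qed.

Lemma cle_anti : antisymmetric cle.
Proof.
move=> k l kl; rewrite -(cardinal_ofK k) -(cardinal_ofK l).
by apply/eqmodP; rewrite /= /equipotent card_eq_le.
Qed.

Lemma cle_trans : transitive cle.
Proof. by move=> l k m; exact: card_le_trans. Qed.

(* The ring display makes the order notations of ring_scope available. *)
HB.instance Definition _ := Order.isPOrder.Build ring_display cardinal
  (fun _ _ => erefl) cle_refl cle_anti cle_trans.

Lemma cle_of (T U : small) :
  cle (cardinal_of T) (cardinal_of U) <-> exists f : T -> U, injective f.
Proof.
have [f [f' fK f'K]] := repr_cardinal_of T.
have [g [g' gK g'K]] := repr_cardinal_of U.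
split=> [/card_leP[h]|[h hI]].
  have u (t : T) : [set: repr (cardinal_of T)] (f' t) by [].
  exists (fun t => g (val (h (SigSub (mem_set (u t)))))) => x y.
  move=> /(can_inj gK)/val_inj /(@inj _ _ _ h _ _ (mem_set I) (mem_set I)).
  by move=> /(congr1 val) /= /(can_inj f'K).
have /injfunPex[k] :
    exists2 k : repr (cardinal_of T) -> repr (cardinal_of U),
      set_fun setT setT k & set_inj setT k.
  exists (g' \o h \o f) => // x y _ _ /=.
  by move=> /(can_inj g'K)/hI/(can_inj fK).
exact: (inj_card_le k).
Qed.

Lemma cle_total : total cle.
Proof.
move=> k l; rewrite -(cardinal_ofK k) -(cardinal_ofK l).
move: (repr k) (repr l) => T U.
pose P (G : set (T * U)) := forall x y, G x -> G y -> (x.1 = y.1 <-> x.2 = y.2).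
have [|G [PG Gmax]] := @Zorn_bigcup _ P.
  move=> F FF Ftot x y [A FA Ax] [B FB By]; have [AB|BA] := Ftot _ _ FA FB.
    exact: (FF B FB) (AB _ Ax) By.
  exact: (FF A FA) Ax (BA _ By).
have [tot|] := pselect (forall t, exists u, G (t, u)).
  have [f Gf] := choice tot; apply/orP; left; apply/cle_of; exists f => x y e.
  exact: (PG _ _ (Gf x) (Gf y)).2.
move=> /existsNP[t /forallNP Gt].
have tot u : exists t, G (t, u).
  apply: contrapT => /forallNP Gu.
  apply: (Gmax (G `|` [set (t, u)])).
    split=> [|/(_ (t, u) (or_intror erefl))]; [by left|exact: Gt].
  move=> [x1 x2] [y1 y2] [Gx|[-> ->]] [Gy|[-> ->]] //=; first exact: PG Gx Gy.
    by split=> e; [case: (Gt x2)|case: (Gu x1)]; rewrite -e.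
  by split=> e; [case: (Gt y2)|case: (Gu y1)]; rewrite e.
have [f Gf] := choice tot; apply/orP; right; apply/cle_of; exists f => x y e.
exact: (PG _ _ (Gf x) (Gf y)).1.
Qed.

HB.instance Definition _ :=
  Order.POrder_isTotal.Build ring_display cardinal cle_total.

Definition infinite_cardinal (k : cardinal) : Prop := infinite_set [set: repr k].

Section PowerSeries.
Variable R : nzSemiRingType.

Record powerseries := PowerSeries { pscoef :> nat -> R }.

HB.instance Definition _ := gen_eqMixin powerseries.
HB.instance Definition _ := gen_choiceMixin powerseries.

Lemma powerseriesP (f g : powerseries) : f =1 g <-> f = g.
Proof. by split=> [|->//]; case: f g => f [g] /= /funext ->. Qed.

Definition psadd (f g : powerseries) := PowerSeries (fun n => f n + g n).
Definition pszero := PowerSeries (fun=> 0).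
Definition psone := PowerSeries (fun n => (n == 0%N)%:R).
Definition psmul (f g : powerseries) :=
  PowerSeries (fun n => \sum_(i < n.+1) f i * g (n - i)%N).

Lemma psaddA : associative psadd.
Proof. by move=> f g h; apply/powerseriesP => n /=; rewrite addrA. Qed.
Lemma psaddC : commutative psadd.
Proof. by move=> f g; apply/powerseriesP => n /=; rewrite addrC. Qed.
Lemma psadd0 : left_id pszero psadd.
Proof. by move=> f; apply/powerseriesP => n /=; rewrite add0r. Qed.

Lemma psmulE f g n : psmul f g n = \sum_(i < n.+1) f i * g (n - i)%N.
Proof. by []. Qed.

Lemma psmul_rev f g n : psmul f g n = \sum_(i < n.+1) f (n - i)%N * g i.
Proof.
rewrite /= (reindex_inj rev_ord_inj) /=.
by apply: eq_bigr => i _; rewrite (sub_ordK i).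
Qed.

Lemma psmulA : associative psmul.
Proof.
move=> p q r; apply/powerseriesP => i; rewrite [LHS]psmulE [RHS]psmul_rev.
pose coef3 j k := p j * (q (i - j - k)%N * r k).
transitivity (\sum_(j < i.+1) \sum_(k < i.+1 | (k <= i - j)%N) coef3 j k).
  apply: eq_bigr => j _; rewrite psmul_rev big_distrr /=.
  by rewrite (big_ord_narrow_leq (leq_subr _ _)).
rewrite (exchange_big_dep predT) //=; apply: eq_bigr => k _.
transitivity (\sum_(j < i.+1 | (j <= i - k)%N) coef3 j k).
  apply: eq_bigl => j; rewrite -ltnS -(ltnS j) -!subSn ?leq_ord //.
  by rewrite -subn_gt0 -(subn_gt0 j) -!subnDA addnC.
rewrite (big_ord_narrow_leq (leq_subr _ _)) big_distrl /=.
by apply: eq_bigr => j _; rewrite /coef3 -!subnDA addnC mulrA.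
Qed.

Lemma psmul1 : left_id psone psmul.
Proof.
move=> f; apply/powerseriesP => n /=; rewrite big_ord_recl /= subn0 mul1r.
by rewrite big1 ?addr0// => i _; rewrite mul0r.
Qed.

Lemma psmulr1 : right_id psone psmul.
Proof.
move=> f; apply/powerseriesP => n; rewrite psmul_rev big_ord_recl /= subn0 mulr1.
by rewrite big1 ?addr0// => i _; rewrite mulr0.
Qed.

Lemma psmulDl : left_distributive psmul psadd.
Proof.
move=> f g h; apply/powerseriesP => n /=; rewrite -big_split /=.
by apply: eq_bigr => i _; rewrite mulrDl.
Qed.

Lemma psmulDr : right_distributive psmul psadd.
Proof.
move=> f g h; apply/powerseriesP => n /=; rewrite -big_split /=.
by apply: eq_bigr => i _; rewrite mulrDr.
Qed.

Lemma psmul0 : left_zero pszero psmul.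
Proof.
by move=> f; apply/powerseriesP => n /=; rewrite big1// => i _; rewrite mul0r.
Qed.

Lemma psmulr0 : right_zero pszero psmul.
Proof.
by move=> f; apply/powerseriesP => n /=; rewrite big1// => i _; rewrite mulr0.
Qed.

Lemma ps1_neq0 : psone != pszero.
Proof. by apply/eqP => /powerseriesP/(_ 0%N)/eqP; rewrite /= oner_eq0. Qed.

HB.instance Definition _ := GRing.isNmodule.Build powerseries
  psaddA psaddC psadd0.
HB.instance Definition _ := GRing.Nmodule_isNzSemiRing.Build powerseries
  psmulA psmul1 psmulr1 psmulDl psmulDr psmul0 psmulr0 ps1_neq0.

End PowerSeries.

(* The supremum over 1 <= i <= n-1 of a_i a_(n-i); it is 0 if the range is
   empty.  The least upper bound exists since cardinals are totally ordered. *)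
Definition conv_sup (a : nat -> cardinal) (n : nat) : cardinal :=
  supremum (0 : cardinal)
    [set (a i * a (n - i)%N : cardinal) | i in [set i | (1 <= i <= n.-1)%N]].

(* Main.v *)
(* Comparing coefficients, f^2 = f means a_0^2 = a_0 and, for n >= 1,
   a_n = a_0 a_n + a_0 a_n + s_n with s_n the finite sum of the a_i a_(n-i) over
   0 < i < n. Since k * k = k for every infinite cardinal k (Hessenberg), a
   cardinal is additively idempotent iff it is 0 or infinite, and below such a
   cardinal a finite sum is bounded iff its largest term is; so s_n can be
   replaced by the supremum. In case (b), a_n <> 0 forces a_(2n) <> 0, whence an
   infinite support. *)
Require Import Defs.
From mathcomp Require Import all_boot all_order all_algebra.
From mathcomp Require Import boolp classical_sets functions cardinality.

Set Implicit Arguments.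
Unset Strict Implicit.
Unset Printing Implicit Defensive.

Import Order.TTheory GRing.Theory.
Local Open Scope classical_set_scope.
Local Open Scope ring_scope.

(** * Zorn's lemma and squares of infinite types *)

Lemma cle_ofE (T U : small) :
  (cardinal_of T <= cardinal_of U) = ([set: T] #<= [set: U])%card.
Proof.
have E V : equipotent (repr (cardinal_of V)) V.
  by apply/equipotentP; exact: repr_cardinal_of.
by rewrite -(card_le_eqr (E U)) -(card_le_eql (E T)).
Qed.

(** Zorn's lemma is applied to the sets whose union with [A0] satisfies [P]; the empty chain is then
    covered by [P A0], so closure is only asked of nonempty chains. *)
Lemma Zorn_bigcup_above (T : Type) (P : set (set T)) (A0 : set T) :
    P A0 ->
    (forall F, F !=set0 -> F `<=` P -> total_on F subset ->
       P (\bigcup_(X in F) X)) ->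
  exists A, [/\ A0 `<=` A, P A & forall B, A `<=` B -> P B -> B `<=` A].
Proof.
move=> PA0 Pcup; have [|A [PA maxA]] := @Zorn_bigcup T [set X | P (X `|` A0)].
  move=> F FP Ftot; rewrite /mkset.
  have [->|F0] := eqVneq F set0; first by rewrite bigcup_set0 set0U.
  have /set0P[X0 FX0] := F0.
  have -> : \bigcup_(X in F) X `|` A0 = \bigcup_(Y in setU^~ A0 @` F) Y.
    apply/seteqP.
    split=> [x [[X FX Xx]|A0x]|x [_ [X FX <-]] [Xx|?]]; last first.
    - by right.
    - by left; exists X.
    - by exists (X0 `|` A0); [exists X0|right].
    - by exists (X `|` A0); [exists X|left].
  apply: Pcup => [|_ [X FX <-]|_ _ [X FX <-] [Y FY <-]].
  - by exists (X0 `|` A0), X0.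
  - exact: FP.
  - by have [XY|YX] := Ftot _ _ FX FY; [left|right]; apply: setSU.
exists (A `|` A0); split=> // B AB PB x Bx; apply: contrapT => Ax.
have A0B : B `|` A0 = B.
  by apply/setUidPl => y A0y; apply: AB; right.
apply: (maxA B); last by rewrite /mkset A0B.
by split=> [y Ay|/(_ x Bx) ?]; [apply: AB; left|apply: Ax; left].
Qed.

Section Pairing.
Variable T : Type.
Implicit Types G H : set (T * T * T).

Definition pairing_base G : set T := [set x | exists z, G (x, x, z)].

(* [G] is the graph of an injection of [A * A] into [A], where the set [A] is
   recovered from the diagonal of the domain. *)
Definition is_pairing G : Prop :=
  [/\ forall p q z w, G (p, z) -> G (q, w) -> (p = q <-> z = w),
      forall x y z, G (x, y, z) ->
        [/\ pairing_base G x, pairing_base G y & pairing_base G z]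
    & forall x y, pairing_base G x -> pairing_base G y ->
        exists z, G (x, y, z)].

Lemma pairing_baseS G H : G `<=` H -> pairing_base G `<=` pairing_base H.
Proof. by move=> GH x [z Gz]; exists z; exact: GH. Qed.

(** Every clause starts from at most two triples of the union, and these lie in a common member of
    the chain. *)
Lemma is_pairing_bigcup (F : set (set (T * T * T))) :
  F `<=` is_pairing -> total_on F subset -> is_pairing (\bigcup_(G in F) G).
Proof.
move=> Fp Ftot; have sub G : F G -> G `<=` \bigcup_(H in F) H.
  by move=> FG x Gx; exists G.
have directed u v : (\bigcup_(G in F) G) u -> (\bigcup_(G in F) G) v ->
    exists G, [/\ F G, G u & G v].
  move=> [G FG Gu] [H FH Hv]; have [GH|HG] := Ftot _ _ FG FH.
    by exists H; split=> //; apply: GH.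
  by exists G; split=> //; apply: HG.
split=> [p q z w /directed /[apply] -[G [/Fp[+ _ _]]]|x y z [G FG Gxyz]|].
- exact.
- have [_ /(_ _ _ _ Gxyz)[Gx Gy Gz] _] := Fp _ FG.
  by split; apply: pairing_baseS (sub _ FG) _ _.
- move=> x y [z /directed Gz] [w /Gz [G [FG Gx Gy]]].
  have [_ _ /(_ x y)[||v Gv]] := Fp _ FG; [by exists z|by exists w|].
  by exists v; exists G.
Qed.

(** Seed for Zorn's lemma: [pickle] injects [nat * nat] into [nat], and [i] carries this over to its
    range. *)
Lemma nat_pairing (i : nat -> T) : injective i ->
  is_pairing [set u | exists m n, u = (i m, i n, i (pickle (m, n)))].
Proof.
move=> iI; set G := [set u | _].
have baseG n : pairing_base G (i n) by exists (i (pickle (n, n))), n, n.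
split=> [p q z w [m [n [-> ->]]] [m' [n' [-> ->]]]|x y z [m [n [-> -> ->]]]|].
- split=> [[/iI-> /iI->]//|/iI/(pcan_inj pickleK)[-> ->]//].
- by [].
- move=> x y [_ [m [_ [-> _ _]]]] [_ [n [_ [-> _ _]]]].
  by exists (i (pickle (m, n))), m, n.
Qed.

End Pairing.

(** Trades an injection of subtypes for a map on all of [T], with a dummy value outside [P]. *)
Lemma cle_sigP (T : Type) (P Q : T -> Prop) :
    cle (cardinal_of {x | P x}) (cardinal_of {x | Q x}) ->
  exists h : T -> T, (forall x, P x -> Q (h x)) /\
    (forall x y, P x -> P y -> h x = h y -> x = y).
Proof.
move=> /cle_of[k kI].
have svalI : injective (@sval T Q).
  by move=> [x Qx] [y Qy] /= xy; case: _ / xy in Qy *; congr exist.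
exists (fun x =>
  if pselect (P x) is left Px then sval (k (exist P x Px)) else x).
split=> [x Px|x y Px Py]; first by case: pselect => // ?; case: (k _).
by case: pselect => // ?; case: pselect => // ? /svalI/kI[].
Qed.

(* A maximal injection [g : A * A -> A] with [A] infinite shows that [A + A]
   embeds into [A]. Either the complement of [A] embeds into [A] and then so
   does the whole type; or [A] has a disjoint copy, and since [(A + A)^2]
   embeds into that copy, [g] extends to the union, against maximality. *)
Lemma infinite_pairing (T : Type) : infinite_set [set: T] ->
  exists f : T * T -> T, injective f.
Proof.
move=> /infiniteP; rewrite -cle_ofE => /cle_of[i iI].
have [F _|G [G0G [Guniq Gdom Gtot] Gmax]] :=
    Zorn_bigcup_above (nat_pairing iI).
  exact: is_pairing_bigcup.
set A := pairing_base G in Gdom Gtot.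
have [a0A a1A] : A (i 0%N) /\ A (i 1%N).
  by split; apply: pairing_baseS G0G _ _;
    [exists (i (pickle (0, 0)%N)), 0%N, 0%N
    |exists (i (pickle (1, 1)%N)), 1%N, 1%N].
have a01 : i 0%N <> i 1%N by move=> /iI.
move: (i 0%N) (i 1%N) a0A a1A a01 => a0 a1 a0A a1A a01.
have /choice[g' Gg'] (p : T * T) : exists z, A p.1 -> A p.2 -> G (p, z).
  case: p => x y; have [[Ax Ay]|nA] := pselect (A x /\ A y).
    by have [z Gz] := Gtot x y Ax Ay; exists z.
  by exists x => Ax Ay; case: nA.
pose g x y := g' (x, y).
have Gg x y : A x -> A y -> G (x, y, g x y) by move=> ? ?; exact: Gg'.
have gA x y : A x -> A y -> A (g x y).
  by move=> Ax Ay; have [] := Gdom _ _ _ (Gg _ _ Ax Ay).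
have gI x y x' y' : g x y = g x' y' -> A x -> A y -> A x' -> A y' ->
    x = x' /\ y = y'.
  move=> E Ax Ay Ax' Ay'.
  by case: (Guniq _ _ _ _ (Gg _ _ Ax Ay) (Gg _ _ Ax' Ay')) => _ /(_ E)[].
(* The points [a0] and [a1] serve as tags: [x] in [A] goes to [g a0 x], and [x] in [C] outside [A]
   goes to [g a1 (h x)], so the two images in [A] are disjoint. *)
have double (h : T -> T) (C : set T) :
    (forall x, C x -> ~ A x -> A (h x)) ->
    (forall x y, C x -> C y -> ~ A x -> ~ A y -> h x = h y -> x = y) ->
  exists e : T -> T, (forall x, C x -> A (e x)) /\
    (forall x y, C x -> C y -> e x = e y -> x = y).
  move=> hA hI; exists (fun x => if `[< A x >] then g a0 x else g a1 (h x)).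
  split=> [x Cx|x y Cx Cy].
    by case: asboolP => Ax; apply: gA => //; exact: hA.
  case: asboolP => Ax; case: asboolP => Ay /gI[]//; do ?exact: hA.
  - by move=> /esym.
  - by move=> _; exact: hI.
have /orP[] := cle_total (cardinal_of {x | ~ A x}) (cardinal_of {x | A x}).
  move=> /cle_sigP[h [hA hI]].
  have [x _|x y _ _|e [eA eI]] := double h setT; [exact: hA|exact: hI|].
  exists (fun p => g (e p.1) (e p.2)) => -[x y] [x' y'] /= /gI[]; do ?exact: eA.
  by move=> /eI-> // /eI->.
move=> /cle_sigP[h [hA hI]].
pose C : set T := A `|` h @` A.
have /choice[h' h'P] (x : T) : exists y, C x -> ~ A x -> A y /\ h y = x.
  have [[?|[y Ay <-]]|] := pselect (C x); [by exists x|by exists y|by exists x].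
have [||e [eA eI]] := double h' C.
- by move=> x Cx nAx; have [] := h'P x Cx nAx.
- move=> x y Cx Cy nAx nAy xy.
  by have [_ <-] := h'P x Cx nAx; have [_ <-] := h'P y Cy nAy; rewrite xy.
(* [N] treats the pairs of [C] that are not pairs of [A]. The outer [h] sends their values outside
   [A], away from the values of [G]. *)
pose N : set (T * T * T) := [set u | exists x y,
  [/\ C x, C y, ~ (A x /\ A y) & u = (x, y, h (g (e x) (e y)))]].
have NCA x y z : N (x, y, z) -> [/\ C x, C y, C z, ~ A z & ~ (A x /\ A y)].
  move=> [x' [y' [Cx Cy nA [-> -> ->]]]].
  have gAe : A (g (e x') (e y')) by apply: gA; exact: eA.
  by split=> //; [right; exists (g (e x') (e y'))|exact: hA].
have baseC : pairing_base (G `|` N) = C.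
  apply/seteqP; split=> [x [z [Gz|/NCA[]//]]|x Cx].
    by left; exists z.
  have [[z Gz]|nAx] := pselect (A x); first by exists z; left.
  by exists (h (g (e x) (e x))); right; exists x, x; split=> // -[].
have GN p z q w : G (p, z) -> N (q, w) -> p <> q /\ z <> w.
  case: p q => [x y] [x' y'] /Gdom[Ax Ay Az] /NCA[_ _ _ nAw nA].
  by split=> [[xx yy]|zw]; [apply: nA; rewrite -xx -yy|apply: nAw; rewrite -zw].
have a0C : C (h a0) by right; exists a0.
have Na0 : N (h a0, h a0, h (g (e (h a0)) (e (h a0)))).
  by exists (h a0), (h a0); split=> // -[/(hA _ a0A)].
(* Maximality would put the triple of [Na0] into [G], hence [h a0] into [A], whereas [h] maps [A]
   outside [A]. *)
suff GNp : is_pairing (G `|` N).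
  have /Gdom[/(hA _ a0A)//] := Gmax _ (@subsetUl _ _ _) GNp _ (or_intror Na0).
rewrite /is_pairing baseC; split.
- move=> p q z w [Gp|Np] [Gq|Nq].
  + exact: Guniq.
  + by have [] := GN _ _ _ _ Gp Nq.
  + by have [qp wz] := GN _ _ _ _ Gq Np; split=> E; [case: qp|case: wz].
  + move: Np Nq => [x [y [Cx Cy _ [-> ->]]]] [x' [y' [Cx' Cy' _ [-> ->]]]].
    split=> [[-> ->]//|/hI/gI[]]; do ?[exact: eA|by apply: gA; exact: eA].
    by move=> /eI-> // /eI->.
- by move=> x y z [/Gdom[? ? ?]|/NCA[]//]; split; left.
- move=> x y Cx Cy; have [[Ax Ay]|nA] := pselect (A x /\ A y).
    by have [z Gz] := Gtot x y Ax Ay; exists z; left.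
  by exists (h (g (e x) (e y))); right; exists x, y.
Qed.

(** * Order and arithmetic of cardinals *)

Implicit Types k l : cardinal.

(** Passes to the form [cardinal_of T], on which [cle_of], [caddE] and [cmulE] act. *)
Lemma cardinalW (P : cardinal -> Prop) :
  (forall T : small, P (cardinal_of T)) -> forall k, P k.
Proof. by move=> PT k; rewrite -(cardinal_ofK k). Qed.

Lemma cle0 k : (0 : cardinal) <= k.
Proof. by elim/cardinalW: k => T; apply/cle_of; exists (of_void T) => -[]. Qed.

Lemma cle_eq0 k : k <= 0 -> k = 0.
Proof. by move=> k0; apply/le_anti; rewrite k0 cle0. Qed.

Lemma cle_addl k l : k <= l + k.
Proof.
elim/cardinalW: k => T; elim/cardinalW: l => U.
by rewrite [_ + _]caddE; apply/cle_of; exists inr => x y [].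
Qed.

Lemma cle_addr k l : k <= k + l.
Proof. by rewrite addrC cle_addl. Qed.

Lemma cle_add k k' l l' : k <= k' -> l <= l' -> k + l <= k' + l'.
Proof.
elim/cardinalW: k => T; elim/cardinalW: k' => T'.
elim/cardinalW: l => U; elim/cardinalW: l' => U'.
move=> /cle_of[f fI] /cle_of[g gI]; rewrite ![_ + _]caddE; apply/cle_of.
exists (fun x => match x with inl t => inl (f t) | inr u => inr (g u) end).
by move=> [x|x] [y|y] // [] => [/fI|/gI] ->.
Qed.

Lemma cle_mul k k' l l' : k <= k' -> l <= l' -> k * l <= k' * l'.
Proof.
elim/cardinalW: k => T; elim/cardinalW: k' => T'.
elim/cardinalW: l => U; elim/cardinalW: l' => U'.
move=> /cle_of[f fI] /cle_of[g gI]; rewrite ![_ * _]cmulE; apply/cle_of.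
by exists (fun x => (f x.1, g x.2)) => -[? ?] [? ?] [/fI-> /gI->].
Qed.

Lemma cle1 k : k <> 0 -> (1 : cardinal) <= k.
Proof.
elim/cardinalW: k => T T0; have [nT|t] := pselectT T; last first.
  by apply/cle_of; exists (fun=> t) => -[] [].
case: T0; apply/cardinal_ofP.
by exists (fun t => match nT t with end), (of_void T) => [t|[]]; case: (nT t).
Qed.

Lemma cmulf_neq0 k l : k <> 0 -> l <> 0 -> k * l <> 0.
Proof.
move=> /cle1 k1 /cle1 l1 kl0; have := cle_mul k1 l1.
by rewrite kl0 mulr1 => /cle_eq0/eqP; rewrite oner_eq0.
Qed.

Lemma infinite_cardinalE k : infinite_cardinal k <-> cardinal_of nat <= k.
Proof.
rewrite -{2}(cardinal_ofK k) cle_ofE; exact: infiniteP.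
Qed.

Lemma infinite_cardinal_le k l :
  infinite_cardinal k -> k <= l -> infinite_cardinal l.
Proof. by rewrite !infinite_cardinalE; exact: le_trans. Qed.

Lemma cle2 k : k <> 0 -> k <> 1 -> (2%:R : cardinal) <= k.
Proof.
elim/cardinalW: k => T T0 T1; rewrite mulr2n [1 + 1]caddE; apply/cle_of.
have /cle_of[f _] := cle1 T0; pose t := f tt.
have [[u tu]|Tt] := pselect (exists u, t <> u).
  exists (fun x : unit + unit => if x is inl _ then t else u).
  by move=> [[]|[]] [[]|[]] //= /esym.
case: T1; apply/cardinal_ofP; exists (fun=> tt), (fun=> t) => [x|[]//].
by apply: contrapT => tx; apply: Tt; exists x.
Qed.

(* [k + 1 <= k] makes [k] Dedekind-infinite. *)
Lemma infinite_cardinal_succ k : k + 1 <= k -> infinite_cardinal k.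
Proof.
move=> k1; apply/infinite_cardinalE; elim/cardinalW: k k1 => T.
rewrite [_ + _]caddE => /cle_of[f fI]; apply/cle_of.
exists (fun n => iter n (f \o inl) (f (inr tt))).
by elim=> [|m IHm] [|n] //= /fI // [/IHm ->].
Qed.

Lemma infinite_cardinal_neq0 k : infinite_cardinal k -> k <> 0.
Proof.
by move=> /infinite_cardinalE + k0; rewrite k0 => /cle_of[f _]; case: (f 0%N).
Qed.

Lemma infinite_cardinal_sqr k : infinite_cardinal k -> k * k = k.
Proof.
move=> kinf; apply/le_anti/andP; split.
  have [f fI] := infinite_pairing kinf; rewrite -{3}(cardinal_ofK k).
  by apply/cle_of; exists f.
rewrite -{1}[k]mulr1; apply: cle_mul => //.
exact/cle1/infinite_cardinal_neq0.
Qed.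

(** Sandwich [1 * k <= l * k <= k * k], whose outer terms both equal [k]. *)
Lemma cmul_absorb k l : infinite_cardinal k -> l <> 0 -> l <= k -> l * k = k.
Proof.
move=> kinf l0 lk; apply/le_anti/andP; split.
  by rewrite -[leRHS]infinite_cardinal_sqr// cle_mul.
by rewrite -{1}[k]mul1r cle_mul// cle1.
Qed.

Lemma infinite_cardinal_double k : infinite_cardinal k -> k + k = k.
Proof.
move=> kinf; have nat2 : (2%:R : cardinal) <= cardinal_of nat.
  rewrite mulr2n [1 + 1]caddE; apply/cle_of.
  exists (fun x : unit + unit => if x is inl _ then 0%N else 1%N).
  by move=> [[]|[]] [[]|[]].
rewrite -mulr2n -mulr_natl; apply: cmul_absorb => //.
  move=> two0; have := cle_addr 1 1; rewrite -mulr2n two0 => /cle_eq0/eqP.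
  by rewrite oner_eq0.
exact: le_trans ((infinite_cardinalE k).1 kinf).
Qed.

(** If [k] is nonzero and [k + k = k], then [k + 1 <= k + k = k], so [k] is infinite. *)
Lemma cadd_idem k : k + k = k <-> k = 0 \/ infinite_cardinal k.
Proof.
split=> [kk|[->|/infinite_cardinal_double//]]; last by rewrite addr0.
have [->|/eqP/cle1 k1] := eqVneq k 0; [by left|right].
by apply: infinite_cardinal_succ; rewrite -[leRHS]kk cle_add.
Qed.

(** Once [2 <= k], one has [k + k = 2 * k <= k * k = k], which reduces to additive idempotence. *)
Lemma cmul_idem k : k * k = k <-> [\/ k = 0, k = 1 | infinite_cardinal k].
Proof.
split=> [kk|[->|->|/infinite_cardinal_sqr//]]; last 2 first.
- by rewrite mulr0.
- by rewrite mulr1.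
have [->|/eqP k0] := eqVneq k 0; first exact: Or31.
have [->|/eqP k1] := eqVneq k 1; first exact: Or32.
have /cadd_idem[] // : k + k = k; last by move=> ?; exact: Or33.
apply/le_anti; rewrite cle_addr andbT -[leRHS]kk -mulr2n -mulr_natl.
by rewrite cle_mul// cle2.
Qed.

Lemma cle_sum (I : eqType) (r : seq I) (P : pred I) (F : I -> cardinal) j :
  j \in r -> P j -> F j <= \sum_(i <- r | P i) F i.
Proof. by move=> jr Pj; rewrite (big_rem j)//= Pj cle_addr. Qed.

(** Since [k + k = k], the cardinals below [k] are closed under finite sums; this covers [k = 0] as
    well as infinite [k]. *)
Lemma sum_cle (I : eqType) (r : seq I) (P : pred I) (F : I -> cardinal) k :
  k + k = k -> (forall i, i \in r -> P i -> F i <= k) ->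
  \sum_(i <- r | P i) F i <= k.
Proof.
move=> kk Fk; rewrite big_seq_cond; elim/big_ind: _ => [|x y xk yk|i /andP[]].
- exact: cle0.
- by rewrite -kk cle_add.
- exact: Fk.
Qed.

(** * Coefficients of the square of a power series *)

Section IdempotentPowerSeries.
Variable f : powerseries cardinal.

(** For positive [n], this is coefficient [n] of [f ^+ 2] without the two end terms, which involve
    [f 0]. *)
Let s n := \sum_(1 <= i < n) f i * f (n - i)%N.

(** For [n > 1] the index range is finite and nonempty, so a largest term exists and is a least
    upper bound; for [n = 1] the range is empty and the supremum is [0]. *)
Lemma conv_sup_cle n k : (0 < n)%N ->
  conv_sup f n <= k <-> forall i, (0 < i < n)%N -> f i * f (n - i)%N <= k.
Proof.
move=> n_gt0.
pose A :=
  [set (f i * f (n - i)%N : cardinal) | i in [set i | (0 < i < n)%N]].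
have -> : conv_sup f n = supremum (0 : cardinal) A.
  by rewrite /A; case: (n) n_gt0.
have [n1|n1] := leqP n 1.
  have noi i : ~ (0 < i < n)%N.
    by move=> /andP[i0 /leq_trans/(_ n1)]; rewrite ltnS leqNgt i0.
  have A0 : A = set0 by apply/seteqP; split=> // x [i /noi].
  by rewrite A0 supremum0; split=> [_ i /noi|_]; last exact: cle0.
have sup : supremums A !=set0.
  pose F (i : 'I_n) := f i * f (n - i)%N.
  have [j Pj Fmax] := @arg_maxP _ _ 'I_n (Ordinal n1) (fun i => 0 < i)%N F isT.
  exists (F j); split=> [_ [i /andP[i0 ni] <-]|x].
    exact: (Fmax (Ordinal ni)).
  by apply; exists (val j) => //=; rewrite /mkset Pj ltn_ord.
have A0 : A != set0 by apply/set0P; exists (f 1%N * f (n - 1)%N), 1%N.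
have [ub lub] : supremums A (supremum (0 : cardinal) A).
  by rewrite /supremum (negbTE A0); case: sup => x; exact: xgetI.
split=> [le_k i lt_i|le_k]; first by apply: le_trans le_k; apply: ub; exists i.
by apply: lub => _ [i lt_i <-]; exact: le_k.
Qed.

Lemma conv_sup_sum n : (0 < n)%N -> conv_sup f n <= s n.
Proof.
move=> n0; apply/conv_sup_cle => // i lt_i; rewrite /s.
by rewrite (@cle_sum _ _ _ (fun i => f i * f (n - i)%N))// mem_index_iota.
Qed.

Lemma sum_conv_sup n k :
  (0 < n)%N -> k + k = k -> conv_sup f n <= k -> s n <= k.
Proof.
move=> n0 kk /conv_sup_cle-/(_ n0) le_k; apply: sum_cle => // i.
by rewrite mem_index_iota => /le_k.
Qed.

Lemma psqr_idem : f ^+ 2 = f <-> f 0%N * f 0%N = f 0%N /\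
  forall n, (0 < n)%N -> f 0%N * f n + f 0%N * f n + s n = f n.
Proof.
have E n : (0 < n)%N -> (f ^+ 2) n = f 0%N * f n + f 0%N * f n + s n.
  case: n => // n _; rewrite expr2 [LHS]psmulE.
  (* The first and last terms are split off; commutativity makes both equal to [f 0 * f n.+1]. *)
  rewrite -(big_mkord xpredT (fun i => f i * f (n.+1 - i)%N)).
  rewrite big_nat_recl// big_nat_recr//= subn0 subnn [f n.+1 * _]mulrC.
  by rewrite [X in _ + X = _]addrC addrA /s big_add1.
have E0 : (f ^+ 2) 0%N = f 0%N * f 0%N.
  by rewrite expr2 [LHS]psmulE big_ord1.
split=> [ff|[f0 fn]]; first by split=> [|n n0]; rewrite -?E0 -?E// ff.
by apply/powerseriesP => -[|n]; rewrite ?E0 ?E// fn.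
Qed.

End IdempotentPowerSeries.

Theorem corollary3p14 (f : powerseries cardinal) :
  (f 0%N ^+ 2 = f 0%N <-> [\/ f 0%N = 0, f 0%N = 1 | infinite_cardinal (f 0%N)])
  /\
  (f ^+ 2 = f <->
   [/\ f 0%N ^+ 2 = f 0%N,
       f 0%N = 0 -> f = 0,
       f 0%N = 1 ->
         f = 1 \/
         [/\ forall n, (1 <= n)%N -> f n <> 0 -> infinite_cardinal (f n),
             infinite_set [set n | (1 <= n)%N /\ f n <> 0]
           & forall n, (1 <= n)%N -> conv_sup f n <= f n]
     & infinite_cardinal (f 0%N) ->
         forall n, (1 <= n)%N ->
           [/\ f n = 0 \/ infinite_cardinal (f n) /\ f 0%N <= f n,
               f n <> 0 -> conv_sup f n <= f n
             & f n = 0 -> conv_sup f n = 0]]).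
Proof.
split; first by rewrite expr2; exact: cmul_idem.
rewrite psqr_idem expr2; split=> [[f0 fE]|[f0 f00 f01 finf]].
  split=> //.
  (* With [f 0 = 0] only the inner sum survives, and each of its terms has a factor of smaller
     positive index, zero by induction. *)
  - move=> f00; apply/powerseriesP; elim/ltn_ind => -[//|n] IHn.
    rewrite -fE// f00 !mul0r !add0r big_nat big1// => i /andP[i0 ni].
    by rewrite IHn// mul0r.
  - move=> f01; have [->|/eqP f1] := eqVneq f 1; [by left|right].
    have fsup n : (0 < n)%N -> conv_sup f n <= f n.
      by move=> n0; rewrite -fE// (le_trans (conv_sup_sum _ n0))// cle_addl.
    have fdouble n : (0 < n)%N -> f n + f n = f n.
      move=> n0; apply/le_anti; rewrite cle_addl andbT -[leRHS]fE//.
      by rewrite f01 !mul1r cle_addr.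
    split=> [n n0 fn0|fin|//]; first by have /cadd_idem[] := fdouble n n0.
    apply: f1; apply/powerseriesP => -[//|n]; apply: contrapT => fn.
    (* The middle term of the supremum at [p.*2] gives [f p * f p <= f p.*2], so nonvanishing passes
       from [p] to [p.*2]. *)
    have f2 m : f (n.+1 * 2 ^ m)%N <> 0.
      elim: m => [|m]; first by rewrite muln1.
      rewrite expnS mulnCA mul2n; set p := (n.+1 * _)%N => fp f2p.
      have p0 : (0 < p)%N by rewrite muln_gt0 expn_gt0.
      have := (conv_sup_cle _ _ _).1 (fsup p.*2 _) p.
      rewrite double_gt0 -addnn addnK p0 -[X in (X < _)%N]addn0 ltn_add2l p0.
      rewrite addnn f2p.
      by move=> /(_ isT isT isT)/cle_eq0; exact: cmulf_neq0.
    apply: infinite_nat.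
    (* The injective map from [m] to [n.+1 * 2 ^ m] lands in the support, so a finite support would
       make [nat] finite. *)
    have /(finite_preimage (f := fun m => (n.+1 * 2 ^ m)%N)) := fin.
    rewrite (_ : _ @^-1` _ = setT); first apply.
      move=> i j _ _ /eqP; rewrite eqn_pmul2l// => /eqP; exact: expnI.
    apply/seteqP; split=> // m _; split; last exact: f2.
    by rewrite muln_gt0 expn_gt0.
  - move=> finf n n0.
    have f0n : f 0%N * f n <= f n by rewrite -[leRHS]fE// -addrA cle_addr.
    have sup : conv_sup f n <= f n.
      by rewrite -fE// (le_trans (conv_sup_sum _ n0))// cle_addl.
    split=> // [|fn0]; last by apply: cle_eq0; rewrite -fn0.
    have [->|/eqP fn] := eqVneq (f n) 0; [by left|right].
    (* As [f n] is nonzero, [f 0 = f 0 * 1 <= f 0 * f n <= f n]. *)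
    suff f0fn : f 0%N <= f n by split=> //; exact: infinite_cardinal_le f0fn.
    by rewrite (le_trans _ f0n)// -{1}[f 0%N]mulr1 cle_mul// cle1.
split=> // n n0.
(* These facts hold in all three cases. They turn the coefficient equation into [f n + s n = f n],
   which holds because [s n <= f n] and [f n + f n = f n]. *)
suff [f0n fn sup] :
    [/\ f 0%N * f n = f n, f n + f n = f n & conv_sup f n <= f n].
  rewrite f0n fn; apply/le_anti; rewrite cle_addr andbT -[leRHS]fn cle_add//.
  exact: sum_conv_sup.
have [/f00->|f0E|f0inf] := (cmul_idem (f 0%N)).1 f0.
- split; rewrite ?mul0r ?addr0//; apply/conv_sup_cle => // i _.
  by rewrite mul0r cle0.
- have [->|[fninf _ sup]] := f01 f0E.
    case: n n0 => // n _; split; rewrite ?mulr0 ?addr0//.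
    apply/conv_sup_cle => // -[|i] //= _; by rewrite mul0r cle0.
  split; [by rewrite f0E mul1r| |exact: sup].
  apply/cadd_idem; have [->|/eqP fn0] := eqVneq (f n) 0; [by left|right].
  exact: fninf.
- have [fn supN sup0] := finf f0inf n n0; split.
  + case: fn => [->|[fn le_fn]]; first by rewrite mulr0.
    by apply: cmul_absorb => //; exact: infinite_cardinal_neq0.
  + by apply/cadd_idem; case: fn => [|[]]; [left|right].
  + by have [fn0|/eqP/supN//] := eqVneq (f n) 0; rewrite sup0// fn0.
Qed.
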